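(* For any unital $C^*$-algebra $A$ with a free action of $\mathbb{Z}_2$, generated by an involution $\sigma$ of $A$, there exists a $\mathbb{Z}_2$-equivariant $*$-homomorphism $\phi\colon A\to\Sigma A$ (that is, $\phi\circ\sigma=\sigma_\Sigma\circ\phi$) if and only if there exists a $\mathbb{Z}_2$-equivariant $*$-homomorphism $\gamma\colon A\to\Gamma A$ (that is, $\sigma\circ\mathrm{ev}_{1/2}\circ\gamma=\mathrm{ev}_{1/2}\circ\gamma\circ\sigma$). Thus the following two conjectural assertions are equivalent: (1) for a unital $C^*$-algebra $A$ with a free action of $\mathbb{Z}_2$ there is no $\mathbb{Z}_2$-equivariant $*$-homomorphism $A\to\Sigma A$; (2) for a unital $C^*$-algebra $A$ with a free action of $\mathbb{Z}_2$ there is no $\mathbb{Z}_2$-equivariant $*$-homomorphism $A\to\Gamma A$.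
   Context: For a unital $C^*$-algebra $A$, identify $\mathbb{C}$ with $\mathbb{C}\cdot 1_A\subseteq A$, and let $\mathrm{ev}_t$ denote evaluation at $t$. The suspension of $A$ is the $C^*$-algebra $$\Sigma A:=\{\alpha\in C([0,1],A) : \mathrm{ev}_0(\alpha)\in\mathbb{C},\ \mathrm{ev}_1(\alpha)\in\mathbb{C}\},$$ and the cone of $A$ is the $C^*$-algebra $$\Gamma A:=\{\alpha\in C([0,\tfrac12],A) : \mathrm{ev}_0(\alpha)\in\mathbb{C}\}.$$ An action of $\mathbb{Z}_2$ on $A$ is generated by an involution $\sigma$ of $A$, i.e. a $*$-automorphism with $\sigma\circ\sigma=\mathrm{id}_A$. It induces the involution $\sigma_\Sigma$ of $\Sigma A$ given by $(\sigma_\Sigma(\alpha))(t)=\sigma(\alpha(1-t))$, which generates the $\mathbb{Z}_2$-action on $\Sigma A$. Equivariance of a map $\gamma\colon A\to\Gamma A$ is only required at the boundary $t=\tfrac12$, in the sense $\sigma\circ\mathrm{ev}_{1/2}\circ\gamma=\mathrm{ev}_{1/2}\circ\gamma\circ\sigma$. The action generated by $\sigma$ is free (in the standard sense of Ellwood for compact quantum group actions, specialized to $\mathbb{Z}_2$) if the linear span of $\{(ab,\,a\sigma(b)) : a,b\in A\}$ is norm dense in $A\oplus A$; for $A=C(X)$ with $X$ compact Hausdorff this is the usual freeness of the action on $X$. *)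

(* Defs.v *)
From HB Require Import structures.
From mathcomp Require Import all_boot all_order all_algebra.
From mathcomp Require Import complex.
From mathcomp Require Import all_classical all_reals all_analysis.

Set Implicit Arguments.
Unset Strict Implicit.
Unset Printing Implicit Defensive.

Import Order.TTheory GRing.Theory Num.Theory.
Import numFieldNormedType.Exports.

Local Open Scope classical_set_scope.
Local Open Scope ring_scope.
Local Open Scope complex_scope.

(* [algType] provides the unit and excludes the zero algebra, so [c |-> c%:A]
   embeds C into A. *)
HB.mixin Record Algebra_isStar (R : realType) A of GRing.Algebra R[i] A := {
  star : A -> A;
  starK : involutive star;
  starD : {morph star : x y / x + y};
  starZ : forall (c : R[i]) (x : A), star (c *: x) = c^* *: star x;
  starM : forall x y : A, star (x * y) = star y * star x
}.

#[short(type="starAlgType")]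
HB.structure Definition StarAlgebra (R : realType) :=
  {A of Algebra_isStar R A & GRing.Algebra R[i] A}.

HB.mixin Record StarAlgebra_isNormed (R : realType) A of StarAlgebra R A := {
  cnorm : A -> R;
  cnormD : forall x y : A, cnorm (x + y) <= cnorm x + cnorm y;
  cnormZ : forall (c : R[i]) (x : A), cnorm (c *: x) = Normc.normc c * cnorm x;
  cnorm0_eq0 : forall x : A, cnorm x = 0 -> x = 0;
  cnormM : forall x y : A, cnorm (x * y) <= cnorm x * cnorm y;
  cnorm_star : forall x : A, cnorm (star x * x) = cnorm x ^+ 2
}.

#[short(type="preCstarAlgType")]
HB.structure Definition PreCStarAlgebra (R : realType) :=
  {A of StarAlgebra_isNormed R A & StarAlgebra R A}.

(* No HB structure can join a ring with a normed module (in the library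
   [numDomainType] already is that join), so the norm topology lives on a copy
   [normed A] of the vector space A. *)
Definition normed (R : realType) (A : preCstarAlgType R) : Type := A.

Section normed_module.
Context {R : realType} (A : preCstarAlgType R).

Local Definition cnormC (x : normed A) : R[i] := (cnorm (x : A))%:C.

Local Lemma cnormC_D (x y : A) : cnormC (x + y) <= cnormC x + cnormC y.
Proof. by rewrite /cnormC -rmorphD/= lecR cnormD. Qed.

Local Lemma cnormC_Z (c : R[i]) (x : A) :
  cnormC (c *: x) = `|c| * cnormC x.
Proof. by rewrite /cnormC cnormZ rmorphM. Qed.

Local Lemma cnormC0_eq0 (x : A) : cnormC x = 0 -> x = 0.
Proof. by move=> [] /cnorm0_eq0. Qed.

HB.instance Definition _ := GRing.Lmodule.copy (normed A) A.
HB.instance Definition _ := Lmodule_isNormed.Build R[i] (normed A)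
  cnormC_D cnormC_Z cnormC0_eq0.

Lemma normedE (x : normed A) : `|x| = (cnorm (x : A))%:C.
Proof. by []. Qed.

End normed_module.

HB.mixin Record PreCStarAlgebra_isComplete (R : realType) A
    of PreCStarAlgebra R A := {
  cauchy_cvg_normed : forall F : set_system (normed A),
    ProperFilter F -> cauchy F -> cvg F
}.

#[short(type="cstarAlgType")]
HB.structure Definition CStarAlgebra (R : realType) :=
  {A of PreCStarAlgebra_isComplete R A & PreCStarAlgebra R A}.

HB.instance Definition _ (R : realType) (A : cstarAlgType R) :=
  Uniform_isComplete.Build (normed A) (@cauchy_cvg_normed R A).
HB.instance Definition _ (R : realType) (A : cstarAlgType R) :=
  CompleteNormedModule.on (normed A).

(* *-homomorphisms are unital: otherwise the zero map would be equivariant for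
   every action. Their continuity is a theorem for C*-algebras, not an axiom. *)
HB.mixin Record isStarMorphism (R : realType) (A B : starAlgType R)
    (f : A -> B) := {
  star_morph : {morph f : x / star x}
}.

#[short(type="starHom")]
HB.structure Definition StarMorphism (R : realType) (A B : starAlgType R) :=
  {f of isStarMorphism R A B f & @GRing.LRMorphism R[i] A B *:%R f}.

Notation "{ 'starhom' A -> B }" := (starHom A B)
  (at level 0, A at level 98, B at level 99,
   format "{ 'starhom'  A  ->  B }") : type_scope.

Definition scalars (R : realType) (A : starAlgType R) : set A :=
  [set a | exists c : R[i], a = c%:A].

Section star_theory.
Context {R : realType} {A : starAlgType R}.

Lemma star1 : star 1 = 1 :> A.
Proof. by rewrite -[LHS]mulr1 -[X in _ * X]starK -starM mulr1 starK. Qed.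

Lemma scalars1 : scalars (1 : A).
Proof. by exists 1; rewrite scale1r. Qed.

Lemma scalarsB (a b : A) : scalars a -> scalars b -> scalars (a - b).
Proof. by move=> [c ->] [d ->]; exists (c - d); rewrite scalerBl. Qed.

Lemma scalarsZ (k : R[i]) (a : A) : scalars a -> scalars (k *: a).
Proof. by move=> [c ->]; exists (k * c); rewrite scalerA. Qed.

Lemma scalarsM (a b : A) : scalars a -> scalars b -> scalars (a * b).
Proof.
move=> [c ->] [d ->]; exists (c * d).
by rewrite -[LHS]scalerAl mul1r scalerA.
Qed.

Lemma scalars_star (a : A) : scalars a -> scalars (star a).
Proof. by move=> [c ->]; exists c^*; rewrite starZ star1. Qed.

End star_theory.

Section cstar_theory.
Context {R : realType} {A : cstarAlgType R}.

Lemma cnorm_ge0 (x : A) : 0 <= cnorm x.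
Proof. by have := normr_ge0 (x : normed A); rewrite normedE lecR. Qed.

Lemma cnormstar (x : A) : cnorm (star x) = cnorm x.
Proof.
have le_star (y : A) : cnorm y <= cnorm (star y).
  have [y0|y0] := eqVneq (cnorm y) 0; first by rewrite y0 cnorm_ge0.
  rewrite -(@ler_pM2r _ (cnorm y)) ?lt0r ?y0 ?cnorm_ge0//.
  by rewrite -expr2 -cnorm_star cnormM.
by apply/le_anti; rewrite le_star andbT -[X in _ <= cnorm X]starK le_star.
Qed.

Lemma starB (x y : A) : star (x - y) = star x - star y.
Proof. by rewrite starD -scaleN1r starZ rmorphN1 scaleN1r. Qed.

Lemma star_continuous : continuous (star : normed A -> normed A).
Proof.
move=> x.
apply/(@cvgrPdist_lt _ (normed A) (normed A) (nbhs (x : normed A))) => e e0.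
near=> y.
rewrite -[_ - _]starB normedE cnormstar -normedE; near: y.
exact: cvgr_dist_lt.
Unshelve. all: by end_near. Qed.

Lemma cvg_cmul (T : Type) (F : set_system T) (FF : Filter F)
    (f g : T -> normed A) (a b : normed A) :
  f @ F --> a -> g @ F --> b ->
  ((f t : A) * g t : normed A) @[t --> F] --> ((a : A) * b : normed A).
Proof.
have normM (x y : normed A) : `|(x : A) * y : normed A| <= `|x| * `|y|.
  by rewrite !normedE -rmorphM lecR cnormM.
move=> fa gb; apply/cvgrPdist_lt => e e0.
have a1 : 0 < `|a| + 1 by rewrite ltr_wpDl.
have b1 : 0 < `|b| + 1 by rewrite ltr_wpDl.
have e2 : 0 < e / 2 by rewrite divr_gt0.
near=> t.
have -> : ((a : A) * b : normed A) - ((f t : A) * g t : normed A) =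
    ((a - f t : A) * b : normed A) + ((f t : A) * (b - g t) : normed A).
  by rewrite -[RHS]/((a - f t : A) * b + (f t : A) * (b - g t : A) : A)
    -[LHS]/((a : A) * b - (f t : A) * g t : A) mulrBl mulrBr addrA subrK.
rewrite (splitr e) (le_lt_trans (ler_normD _ _))// ltr_leD//.
  rewrite (le_lt_trans (normM _ _))//.
  apply: (@le_lt_trans _ _ (`|a - f t| * (`|b| + 1))).
    by rewrite ler_wpM2l// lerDl.
  rewrite -ltr_pdivlMr//; near: t; apply: cvgr_dist_lt => //.
  exact: divr_gt0.
rewrite (le_trans (normM _ _))//.
apply: (@le_trans _ _ ((`|a| + 1) * `|b - g t|)).
  rewrite ler_wpM2r//.
  have -> : f t = a - (a - f t) by rewrite subKr.
  rewrite (le_trans (ler_normB _ _))// lerD2l.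
  by near: t; apply: cvgr_dist_le.
rewrite mulrC -ler_pdivlMr//; near: t; apply: cvgr_dist_le => //.
exact: divr_gt0.
Unshelve. all: by end_near. Qed.

End cstar_theory.

Section bdC.
Context {R : realType} (T : ptopologicalType) (B : set T) (A : cstarAlgType R).

Definition bdC_pred : {pred (T -> A)} := fun f =>
  `[< continuous (f : T -> normed A) /\ forall t, B t -> scalars (f t) >].

(* Common generalization of the suspension (T = [0, 1], B = {0, 1}) and of the
   cone (T = [0, 1/2], B = {0}).
   Only the *-algebra structure, which is pointwise, is registered: the
   supremum norm plays no role in the notion of *-homomorphism. *)
Record bdC := BdC { bdC_fun :> T -> A; _ : bdC_fun \in bdC_pred }.

HB.instance Definition _ := [isSub for bdC_fun].
HB.instance Definition _ := [Choice of bdC by <:].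

Lemma bdC_subring_closed : subring_closed bdC_pred.
Proof.
split.
- by apply/asboolP; split=> [t|t _]; [exact: cvg_cst|exact: scalars1].
- move=> f g /asboolP[fc fB] /asboolP[gc gB]; apply/asboolP; split=> [t|t Bt].
    by apply: cvgB; [exact: fc|exact: gc].
  by apply: scalarsB; [exact: fB|exact: gB].
- move=> f g /asboolP[fc fB] /asboolP[gc gB]; apply/asboolP; split=> [t|t Bt].
    by apply: cvg_cmul; [exact: fc|exact: gc].
  by apply: scalarsM; [exact: fB|exact: gB].
Qed.

Lemma bdC_scaler_closed : GRing.scaler_closed bdC_pred.
Proof.
move=> c f /asboolP[fc fB]; apply/asboolP; split=> [t|t Bt].
  by apply: cvgZr; exact: fc.
exact/scalarsZ/fB.
Qed.

HB.instance Definition _ := GRing.isSubringClosed.Build (T -> A) bdC_pred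
  bdC_subring_closed.
HB.instance Definition _ := GRing.isScaleClosed.Build R[i] (T -> A) bdC_pred
  bdC_scaler_closed.
HB.instance Definition _ := [SubChoice_isSubNzRing of bdC by <:].
HB.instance Definition _ := [SubZmodule_isSubLmodule of bdC by <:].

Lemma bdC_scalerAl (c : R[i]) (f g : bdC) : c *: (f * g) = c *: f * g.
Proof. by apply/val_inj/funext => t; exact: scalerAl. Qed.

Lemma bdC_scalerAr (c : R[i]) (f g : bdC) : c *: (f * g) = f * (c *: g).
Proof. by apply/val_inj/funext => t; exact: scalerAr. Qed.

HB.instance Definition _ :=
  GRing.Lmodule_isLalgebra.Build R[i] bdC bdC_scalerAl.
HB.instance Definition _ :=
  GRing.Lalgebra_isAlgebra.Build R[i] bdC bdC_scalerAr.

Lemma bdC_star_subproof (f : bdC) : (fun t => star (f t)) \in bdC_pred.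
Proof.
case: f => f /= /asboolP[fc fB]; apply/asboolP; split=> [t|t Bt].
  apply: (@continuous_comp T (normed A) (normed A) f star); first exact: fc.
  exact: star_continuous.
exact/scalars_star/fB.
Qed.

Definition bdC_star (f : bdC) : bdC := BdC (bdC_star_subproof f).

Lemma bdC_starK : involutive bdC_star.
Proof. by move=> f; apply/val_inj/funext => t /=; exact: starK. Qed.

Lemma bdC_starD : {morph bdC_star : f g / f + g}.
Proof. by move=> f g; apply/val_inj/funext => t /=; exact: starD. Qed.

Lemma bdC_starZ (c : R[i]) (f : bdC) : bdC_star (c *: f) = c^* *: bdC_star f.
Proof. by apply/val_inj/funext => t /=; exact: starZ. Qed.

Lemma bdC_starM (f g : bdC) : bdC_star (f * g) = bdC_star g * bdC_star f.
Proof. by apply/val_inj/funext => t /=; exact: starM. Qed.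

HB.instance Definition _ := Algebra_isStar.Build R bdC
  bdC_starK bdC_starD bdC_starZ bdC_starM.

End bdC.

Section itv0.
Context {R : realType} (b : {posnum R}).

Definition itv0 : Type := `[0, b%:num]%classic : set R.

HB.instance Definition _ := Topological.copy itv0
  (set_type (`[0, b%:num]%classic : set R)).

Lemma itv0_bot_subproof : (0 : R) \in `[0, b%:num]%classic.
Proof. by rewrite inE/= in_itv/= lexx/=. Qed.

Lemma itv0_top_subproof : b%:num \in `[0, b%:num]%classic.
Proof. by rewrite inE/= in_itv/= lexx andbT. Qed.

Lemma itv0_flip_subproof (t : itv0) :
  b%:num - set_val t \in `[0, b%:num]%classic.
Proof.
have /= := set_valP t; rewrite in_itv/= => /andP[t0 tb].
by rewrite inE/= in_itv/= subr_ge0 tb/= gerBl.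
Qed.

Definition itv0_bot : itv0 := exist _ 0 itv0_bot_subproof.
Definition itv0_top : itv0 := exist _ b%:num itv0_top_subproof.
Definition itv0_flip (t : itv0) : itv0 :=
  exist _ (b%:num - set_val t) (itv0_flip_subproof t).

HB.instance Definition _ := isPointed.Build itv0 itv0_bot.

End itv0.

Section actions.
Context {R : realType}.

Local Notation I := (itv0 (1%:pos : {posnum R})).
Local Notation J := (itv0 ((2^-1)%:pos : {posnum R})).

Definition suspension (A : cstarAlgType R) : starAlgType R :=
  bdC [set (itv0_bot _ : I); (itv0_top _ : I)] A.

Definition cone (A : cstarAlgType R) : starAlgType R :=
  bdC [set (itv0_bot _ : J)] A.

Context {A : cstarAlgType R}.

(* Stated on all functions [I -> A]: that it preserves [suspension A] requires
   the continuity of the *-automorphism sigma. *)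
Definition suspension_flip (sigma : A -> A) (f : I -> A) : I -> A :=
  fun t => sigma (f (itv0_flip t)).

Definition suspension_equivariant (sigma : A -> A) (phi : A -> suspension A) :=
  forall a : A,
    phi (sigma a) = suspension_flip sigma (phi a) :> (I -> A).

Definition ev_half (f : cone A) : A := f (itv0_top _).

Definition cone_equivariant (sigma : A -> A) (gamma : A -> cone A) :=
  sigma \o ev_half \o gamma = ev_half \o gamma \o sigma.

Definition lin_span (V : lmodType R[i]) (S : set V) : set V :=
  [set v | exists n (c : 'I_n -> R[i]) (s : 'I_n -> V),
     (forall i, S (s i)) /\ v = \sum_(i < n) c i *: s i].

(* [normed A * normed A] carries the maximum norm, the C*-norm of the direct sum
   of A with itself. *)
Definition free_action (sigma : A -> A) :=
  dense (lin_span
    [set ab | exists a b : A, ab = (a * b, a * sigma b)]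
    : set (normed A * normed A)%type).

End actions.

(* Main.v *)
(**
Restricting paths to [0, 1/2] turns phi into gamma.  Conversely, gamma yields
phi by gluing [t |-> gamma a t] on [0, 1/2] to
[t |-> sigma (gamma (sigma a) (1 - t))] on [1/2, 1]; equivariance of gamma at
1/2 is exactly the matching condition there.  The glued path is continuous
because sigma is, as is any *-homomorphism f between C*-algebras: a
self-adjoint h of norm < 1 is the mean of the unitaries
[h +/- i sqrt (1 - h^2)], and f maps unitaries to unitaries, so
[|f h| <= 1]; the C*-identity extends this to all elements.
*)
Require Import Defs.
From HB Require Import structures.
From mathcomp Require Import all_boot all_order all_algebra.
From mathcomp Require Import complex.
From mathcomp Require Import all_classical all_reals all_analysis.

Set Implicit Arguments.
Unset Strict Implicit.
Unset Printing Implicit Defensive.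

Import Order.TTheory GRing.Theory Num.Theory.
Import numFieldNormedType.Exports.

Local Open Scope classical_set_scope.
Local Open Scope ring_scope.
Local Open Scope complex_scope.

(** * Automatic continuity of *-homomorphisms between C*-algebras *)

Section automatic_continuity.
Context {R : realType}.
Implicit Types A B : cstarAlgType R.

Lemma cnorm1 A : cnorm (1 : A) = 1.
Proof.
have n1 : cnorm (1 : A) != 0 by apply/eqP => /cnorm0_eq0/eqP; rewrite oner_eq0.
by apply: (mulIf n1); rewrite mul1r -expr2 -cnorm_star star1 mulr1.
Qed.

Lemma cnorm_real A (r : R) (x : A) : 0 <= r -> cnorm (r%:C *: x) = r * cnorm x.
Proof.
move=> r0; rewrite cnormZ; congr (_ * _).
by rewrite /Normc.normc/= expr0n/= addr0 sqrtr_sqr ger0_norm.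
Qed.

Lemma cnorm0 A : cnorm (0 : A) = 0.
Proof. by rewrite -(scale0r (0 : A)) (@cnorm_real _ 0)// mul0r. Qed.

Lemma star_realZ A (r : R) (x : A) : star (r%:C *: x) = r%:C *: star x.
Proof.
by rewrite starZ; congr (_ *: _); apply: conj_Creal; rewrite complex_real.
Qed.

(** The a priori estimate of Banach's fixed point theorem. The invariant predicate [P] is there
    because the map iterated below contracts only on a ball. *)
Lemma cnorm_iter_contraction A (f : A -> A) (q : R) (P : A -> Prop) (x : A) :
  0 <= q -> P x -> (forall y, P y -> P (f y)) ->
  (forall y z, P y -> P z -> cnorm (f y - f z) <= q * cnorm (y - z)) ->
  forall n m, cnorm (iter (n + m) f x - iter n f x) <=
    q ^+ n * cnorm (iter m f x - x).
Proof.
move=> q0 Px Pf fq n m.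
have Pi k : P (iter k f x) by elim: k => //= k; exact: Pf.
elim: n => [|n IH]; first by rewrite add0n expr0 mul1r.
rewrite addSn !iterS (le_trans (fq _ _ (Pi _) (Pi _)))// exprS -mulrA.
by rewrite ler_wpM2l.
Qed.

Lemma cvg_of_geometric A (y : nat -> normed A) (q c : R) :
  0 <= q < 1 ->
  (forall n m, cnorm (y (n + m)%N - y n : A) <= q ^+ n * c) ->
  cvg (y @ \oo).
Proof.
move=> /andP[q0 q1] yq; apply: cauchy_cvg_normed; apply/cauchyP => e e0.
(* In the order of [R[i]], a positive element has imaginary part zero. *)
have [r r0 ->] : exists2 r : R, 0 < r & e = r%:C.
  case: e e0 => a b; rewrite ltcE/= => /andP[/eqP -> a0]; exists a => //.
have qc : (q ^+ n * c) @[n --> \oo] --> (0 : R).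
  rewrite -(mul0r c); apply: cvgMl; apply: cvg_expr.
  by rewrite ger0_norm.
have /cvgrPdist_lt/(_ r r0)[N _ NP] := qc.
exists (y N); exists N => // n /= Nn.
rewrite -ball_normE/= distrC normedE ltcR -(subnKC Nn).
apply: le_lt_trans (yq _ _) _; apply: le_lt_trans (NP N _) => /=.
  by rewrite sub0r normrN ler_norm.
by rewrite leqnn.
Qed.

(** A square root of 1 - h^2 without functional calculus: it is found as 1 - l, where l is the limit
    of a fixed point iteration started at 0. *)
Lemma cstar_sqrt A (h : A) : star h = h -> cnorm h < 1 ->
  exists s : A, [/\ star s = s, h * s = s * h & s * s = 1 - h * h].
Proof.
move=> hs h1; pose q := cnorm (h * h).
have qE : q = cnorm h ^+ 2 by rewrite -cnorm_star hs.
have q0 : 0 <= q by exact: cnorm_ge0.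
have q1 : q < 1 by rewrite qE expr_lt1// cnorm_ge0.
pose half : R[i] := (2^-1 : R)%:C.
have halfD : half + half = 1.
  by rewrite -(rmorph1 (real_complex R)) [in RHS](splitr 1) div1r rmorphD.
(* A fixed point y of f satisfies (1 - y)^2 = 1 - h^2. *)
pose f (y : A) : A := half *: (h * h + y * y).
have half_ge0 : 0 <= 2^-1 :> R by rewrite invr_ge0.
(* The ball of radius q = |h|^2 < 1 is stable under [f], which is q-Lipschitz there.
   Self-adjointness and commutation with h are carried along so that the limit inherits them. *)
pose P y := [/\ cnorm y <= q, star y = y & h * y = y * h].
have P0 : P 0.
  split; last by rewrite mulr0 mul0r.
    by rewrite cnorm0.
  by rewrite -(subrr 1) starB star1.
have Pf y : P y -> P (f y).
  move=> [yq ys yh]; split.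
  - rewrite cnorm_real// (le_trans (ler_wpM2l half_ge0 (cnormD _ _)))//.
    rewrite -/q ler_pdivrMl// mulr_natl mulr2n lerD2l (le_trans (cnormM _ _))//.
    by rewrite -[leRHS]mulr1 ler_pM ?cnorm_ge0// (le_trans yq)// ltW.
  - by rewrite star_realZ starD !starM hs ys.
  - by rewrite -scalerAr -scalerAl mulrDr mulrDl !mulrA yh -!mulrA yh.
have fq y z : P y -> P z -> cnorm (f y - f z) <= q * cnorm (y - z).
  move=> [yq _ _] [zq _ _].
  (* This factorization of y^2 - z^2 is valid for noncommuting y and z. *)
  have -> : f y - f z = half *: (y * (y - z) + (y - z) * z).
    by rewrite -scalerBr mulrBr mulrBl addrA subrK opprD addrACA subrr add0r.
  rewrite cnorm_real// (le_trans (ler_wpM2l half_ge0 (cnormD _ _)))//.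
  rewrite ler_pdivrMl// mulr_natl mulr2n lerD// (le_trans (cnormM _ _))//.
    by rewrite ler_wpM2r ?cnorm_ge0.
  by rewrite mulrC ler_wpM2r ?cnorm_ge0.
have Pi n : P (iter n f 0) by elim: n => //= n; exact: Pf.
pose y n : normed A := iter n f 0.
have yc : cvg (y @ \oo).
  apply: (@cvg_of_geometric _ _ q q); first by rewrite q0.
  move=> n m; rewrite (le_trans (cnorm_iter_contraction q0 P0 Pf fq n m))//.
  by rewrite ler_wpM2l ?exprn_ge0// subr0; have [] := Pi m.
have [l yl] : exists l : normed A, y @ \oo --> l by exists (lim (y @ \oo)).
(* Identities satisfied by all iterates pass to the limit, since limits in a normed space are
   unique. *)
have lim_eq (g g' : normed A -> normed A) : (forall n, g (y n) = g' (y n)) ->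
    g (y n) @[n --> \oo] --> g l -> g' (y n) @[n --> \oo] --> g' l ->
    g l = g' l.
  move=> gg' gl g'l; apply: (cvg_unique _ gl); first exact: norm_hausdorff.
  by rewrite (_ : (fun n => g (y n)) = fun n => g' (y n))//; exact/funext.
have ls : star (l : A) = l.
  apply: (lim_eq star id) => [n||//].
    by have [] := Pi n.
  exact: (cvg_comp _ _ yl (@star_continuous _ _ l)).
have lh : h * l = l * h.
  apply: (lim_eq (fun z => h * (z : A)) (fun z => (z : A) * h)) => [n||].
  - by have [] := Pi n.
  - by apply: cvg_cmul => //; exact: cvg_cst.
  - by apply: cvg_cmul => //; exact: cvg_cst.
have lE : (l : A) = f l.
  have yS : y n.+1 @[n --> \oo] --> l by rewrite (cvg_shiftS y).
  apply: (cvg_unique _ yS); first exact: norm_hausdorff.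
  apply: cvgZr; apply: cvgD; first exact: cvg_cst.
  exact: cvg_cmul.
exists (1 - l); split.
- by rewrite starB star1 ls.
- by rewrite mulrBr mulrBl mulr1 mul1r lh.
(* The fixed point equation reads 2l = h^2 + l^2, hence 1 - 2l + l^2 = 1 - h^2. *)
- have ll : (l : A) + l = h * h + l * l.
    by rewrite {1 2}lE /f -scalerDl halfD scale1r.
  rewrite mulrBr !mulrBl !mulr1 mul1r -addrA -opprD addrA ll; congr (1 - _).
  by rewrite addrK.
Qed.

Lemma unitary_cnorm A (u : A) : star u * u = 1 -> cnorm u = 1.
Proof.
move=> uu; apply/eqP; rewrite -[_ == _](@eqrXn2 _ 2) ?cnorm_ge0//.
by rewrite -cnorm_star uu cnorm1 expr1n.
Qed.

Lemma starhom_unitary_cnorm A B (f : {starhom A -> B}) (u : A) :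
  star u * u = 1 -> cnorm (f u) = 1.
Proof.
by move=> uu; apply: unitary_cnorm; rewrite -star_morph -rmorphM uu rmorph1.
Qed.

Lemma selfadjoint_unitary_mean A (h : A) : star h = h -> cnorm h < 1 ->
  exists u v : A, [/\ star u * u = 1, star v * v = 1 & h + h = u + v].
Proof.
move=> hs h1; have [s [ss sh s2]] := cstar_sqrt hs h1.
pose im : R[i] := Num.imaginary.
have iC : Num.conj im = - im by exact: conjCi.
have i2 : im * im = -1 by rewrite -expr2 sqrCi.
(* Since h and s commute, the cross terms of (h - is)(h + is) cancel, leaving h^2 + s^2 = 1. *)
exists (h + im *: s), (h - im *: s); split.
- rewrite starD starZ hs ss iC scaleNr mulrDr !mulrBl.
  rewrite -!scalerAr -!scalerAl scalerA i2 scaleN1r opprK s2 sh.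
  by rewrite addrA subrK addrC subrK.
- rewrite starB starZ hs ss iC scaleNr opprK mulrBr !mulrDl.
  rewrite -!scalerAr -!scalerAl scalerA i2 scaleN1r opprD opprK s2 sh.
  by rewrite addrA addrK addrC subrK.
- by rewrite addrACA subrr addr0.
Qed.

Lemma starhom_contractive A B (f : {starhom A -> B}) (x : A) :
  cnorm (f x) <= cnorm x.
Proof.
have sa (h : A) : star h = h -> cnorm h < 1 -> cnorm (f h) <= 1.
  move=> hs h1; have [u [v [uu vv huv]]] := selfadjoint_unitary_mean hs h1.
  have cnorm2 (y : B) : cnorm (y + y) = 2 * cnorm y.
    rewrite -(@cnorm_real _ 2)//; congr cnorm.
    by rewrite -[2]/(1 + 1) (rmorphD (real_complex R)) rmorph1 scalerDl scale1r.
  rewrite -(@ler_pM2l _ 2)// mulr1 -cnorm2 -raddfD huv raddfD.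
  by rewrite (le_trans (cnormD _ _))// !starhom_unitary_cnorm.
(* The element y* y is self-adjoint of norm |y|^2 < 1, and |f y|^2 = |f (y* y)|. *)
have small (y : A) : cnorm y < 1 -> cnorm (f y) <= 1.
  move=> y1.
  rewrite -(@expr_le1 _ 2) ?cnorm_ge0// -cnorm_star -star_morph -rmorphM.
  by apply: sa; rewrite ?starM ?starK// cnorm_star expr_lt1 ?cnorm_ge0.
rewrite leNgt; apply/negP => xfx.
have fx0 : 0 < cnorm (f x) by rewrite (le_lt_trans _ xfx) ?cnorm_ge0.
(* With r strictly between |x| and |f x|, the element x/r has norm below 1 and an image of norm
   above 1. Such an r is positive even if x = 0. *)
have [xr rfx] := midf_lt xfx; set r := (_ / 2) in xr rfx.
have r0 : 0 < r by rewrite (le_lt_trans _ xr) ?cnorm_ge0.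
have ri0 : 0 <= r^-1 by rewrite invr_ge0 ltW.
have := small (r^-1%:C *: x); rewrite linearZ/= !cnorm_real//.
rewrite ltr_pdivrMl// mulr1 => /(_ xr); rewrite ler_pdivrMl// mulr1.
by rewrite leNgt rfx.
Qed.

Lemma starhom_continuous A B (f : {starhom A -> B}) :
  continuous (f : normed A -> normed B).
Proof.
move=> x.
apply/(@cvgrPdist_lt _ (normed B) (normed A) (nbhs (x : normed A))) => e e0.
near=> y.
rewrite -[_ - _](raddfB f) normedE.
apply: (@le_lt_trans _ _ `|(x - y : normed A)|); last first.
  by near: y; exact: cvgr_dist_lt.
by rewrite normedE lecR starhom_contractive.
Unshelve. all: by end_near. Qed.

End automatic_continuity.

(** * Composition, point evaluations and pointwise families of *-homomorphisms *)

Section starhom_comp.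
Context {R : realType} {A B C : starAlgType R}.
Variables (f : {starhom B -> C}) (g : {starhom A -> B}).

Lemma comp_star_morph : {morph f \o g : x / star x}.
Proof. by move=> x /=; rewrite !star_morph. Qed.

HB.instance Definition _ := isStarMorphism.Build R A C (f \o g) comp_star_morph.

End starhom_comp.

Section bdC_eval.
Context {R : realType} {T : ptopologicalType} {S : set T} {A : cstarAlgType R}.

Definition bdC_eval (t : T) (f : bdC S A) : A := f t.

Variable t : T.

Lemma bdC_eval_zmod_morphism : zmod_morphism (bdC_eval t).
Proof. by []. Qed.

Lemma bdC_eval_monoid_morphism : monoid_morphism (bdC_eval t).
Proof. by []. Qed.

Lemma bdC_eval_scalable : scalable (bdC_eval t).
Proof. by []. Qed.

Lemma bdC_eval_star_morph : {morph bdC_eval t : f / star f}.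
Proof. by []. Qed.

HB.instance Definition _ := GRing.isZmodMorphism.Build (bdC S A) A (bdC_eval t)
  bdC_eval_zmod_morphism.
HB.instance Definition _ := GRing.isMonoidMorphism.Build (bdC S A) A
  (bdC_eval t) bdC_eval_monoid_morphism.
HB.instance Definition _ := GRing.isScalable.Build R[i] (bdC S A) A *:%R
  (bdC_eval t) bdC_eval_scalable.
HB.instance Definition _ := isStarMorphism.Build R (bdC S A) A (bdC_eval t)
  bdC_eval_star_morph.

End bdC_eval.

Section bdC_family.
Context {R : realType} {T : ptopologicalType} {S : set T} {A : cstarAlgType R}
  {D : starAlgType R}.
Variable f : T -> {starhom D -> A}.
Hypothesis fS : forall a, (fun t => f t a) \in @bdC_pred R T S A.

(** All operations of [bdC] are pointwise, so a family of *-homomorphisms indexed by [T] becomes a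
    single one into [bdC] once each orbit is continuous with scalar boundary values. Both
    constructions below take this form. *)
Definition bdC_family (a : D) : bdC S A := BdC (fS a).

Lemma bdC_family_zmod_morphism : zmod_morphism bdC_family.
Proof. by move=> a b; apply/val_inj/funext => t; exact: raddfB. Qed.

Lemma bdC_family_monoid_morphism : monoid_morphism bdC_family.
Proof.
by split=> [|a b]; apply/val_inj/funext => t; [exact: rmorph1|exact: rmorphM].
Qed.

Lemma bdC_family_scalable : scalable bdC_family.
Proof. by move=> c a; apply/val_inj/funext => t; exact: linearZ. Qed.

Lemma bdC_family_star_morph : {morph bdC_family : a / star a}.
Proof. by move=> a; apply/val_inj/funext => t; exact: star_morph. Qed.

HB.instance Definition _ := GRing.isZmodMorphism.Build D (bdC S A) bdC_family
  bdC_family_zmod_morphism.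
HB.instance Definition _ := GRing.isMonoidMorphism.Build D (bdC S A) bdC_family
  bdC_family_monoid_morphism.
HB.instance Definition _ := GRing.isScalable.Build R[i] D (bdC S A) *:%R
  bdC_family bdC_family_scalable.
HB.instance Definition _ := isStarMorphism.Build R D (bdC S A) bdC_family
  bdC_family_star_morph.

End bdC_family.

Section bdC_continuity.
Context {R : realType} {T : ptopologicalType} {S : set T} {A : cstarAlgType R}.

Lemma bdC_continuous (f : bdC S A) : continuous (f : T -> normed A).
Proof. by case: f => f /= /asboolP[]. Qed.

Lemma bdC_scalars (f : bdC S A) t : S t -> scalars (f t).
Proof. by case: f => f /= /asboolP[_]; apply. Qed.

End bdC_continuity.

(** * The retraction of the real line onto [0, b] *)

Section itv0_clamp.
Context {R : realType} (b : {posnum R}).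

Lemma itv0_clamp_subproof (x : R) :
  Num.max 0 (Num.min x b%:num) \in `[0, b%:num]%classic.
Proof. by rewrite inE/= in_itv/= le_max lexx/= ge_max ge_min lexx orbT ge0. Qed.

(** A total map, so that points can be moved between [0, 1] and [0, 1/2] without membership
    proofs. *)
Definition itv0_clamp (x : R) : itv0 b :=
  exist _ (Num.max 0 (Num.min x b%:num)) (itv0_clamp_subproof x).

Lemma itv0_clampE (x : R) : 0 <= x <= b%:num -> set_val (itv0_clamp x) = x.
Proof.
by move=> /andP[x0 xb]/=; rewrite /set_val/= (min_idPl xb) (max_idPr x0).
Qed.

Lemma itv0_clampK (t : itv0 b) (x : R) : set_val t = x -> itv0_clamp x = t.
Proof.
by move=> <-; apply/val_inj/itv0_clampE; have := set_valP t; rewrite /= in_itv.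
Qed.

Lemma itv0_clamp_top (x : R) : b%:num <= x -> itv0_clamp x = itv0_top b.
Proof.
by move=> bx; apply/val_inj; rewrite /= (min_idPr bx) (max_idPr _)// ge0.
Qed.

Lemma set_val_itv0_continuous : continuous (set_val : itv0 b -> R).
Proof. exact: initial_continuous. Qed.

Lemma itv0_clamp_continuous : continuous itv0_clamp.
Proof.
apply: (@continuous_comp_initial _ _ _ set_val) => x.
rewrite (_ : _ \o _ = (cst 0 \max ((@id R) \min cst b%:num)))//.
apply: continuous_max; first exact: cst_continuous.
by apply: continuous_min; [exact: cvg_id|exact: cst_continuous].
Qed.

End itv0_clamp.

(** * Passing between equivariant maps into the suspension and into the cone *)

Section suspension_cone.
Context {R : realType} {A : cstarAlgType R} (sigma : {starhom A -> A}).

Let one : {posnum R} := 1%:pos.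
Let half : {posnum R} := (2^-1)%:pos.
Local Notation I := (itv0 one).
Local Notation J := (itv0 half).

Lemma cone_of_suspension (phi : {starhom A -> suspension A}) :
  suspension_equivariant sigma phi ->
  exists gamma : {starhom A -> cone A}, cone_equivariant sigma gamma.
Proof.
move=> phis.
pose f (t : J) : {starhom A -> A} :=
  bdC_eval (itv0_clamp one (set_val t)) \o phi.
have fS a : (fun t => f t a) \in @bdC_pred R J [set (itv0_bot _ : J)] A.
  apply/asboolP; split=> [t|t ->].
    have ct : {for t, continuous (fun t => itv0_clamp one (set_val t) : I)}.
      apply: (@continuous_comp J R I set_val (itv0_clamp one)).
        exact: set_val_itv0_continuous.
      exact: itv0_clamp_continuous.
    exact: (@continuous_comp J I (normed A) _ _ _ ct
      (@bdC_continuous _ _ _ _ (phi a) _)).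
  apply: bdC_scalars; left; exact: itv0_clampK.
exists (bdC_family fS); apply/funext => a /=.
(* The midpoint is fixed by t -> 1 - t, so equivariance of [phi] at this point is the boundary
   condition required of [gamma]. *)
set c : I := itv0_clamp one 2^-1.
have cE : itv0_flip c = c.
  apply/val_inj; rewrite -[LHS]/(1 - set_val c) -[RHS]/(set_val c) itv0_clampE.
    by rewrite [X in X - _](splitr 1) div1r addrK.
  by rewrite invr_ge0 ler0n/= invf_le1// ler1n.
have := congr1 (fun g : I -> A => g c) (phis a).
by rewrite /suspension_flip cE => /esym.
Qed.

Lemma suspension_of_cone (gamma : {starhom A -> cone A}) :
  involutive sigma -> cone_equivariant sigma gamma ->
  exists phi : {starhom A -> suspension A}, suspension_equivariant sigma phi.
Proof.
move=> sK gammas.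
have gs a : sigma (gamma a (itv0_top half)) = gamma (sigma a) (itv0_top half).
  by move: gammas => /funeqP/(_ a).
(* By truncation, p t = min(t, 1/2) and q t = min(1 - t, 1/2): each stays at 1/2 on the half where
   its branch is not selected. *)
pose p (t : I) : J := itv0_clamp half (set_val t).
pose q (t : I) : J := itv0_clamp half (1 - set_val t).
pose f1 (t : I) : {starhom A -> A} := bdC_eval (p t) \o gamma.
pose f2 (t : I) : {starhom A -> A} :=
  sigma \o (bdC_eval (q t) \o (gamma \o sigma)).
pose f t := if set_val t <= 2^-1 then f1 t else f2 t.
have half2 : 1 - 2^-1 = 2^-1 :> R by rewrite [X in X - _](splitr 1) div1r addrK.
(* The last two terms, resp. the outer two, cancel on each half, which makes
   continuity in t evident. *)
have fE t a : f t a = gamma a (p t) + sigma (gamma (sigma a) (q t))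
                      - gamma a (itv0_top half).
  rewrite /f; case: leP => t2 /=.
    rewrite [q t]itv0_clamp_top; first by rewrite -gs sK addrK.
    by rewrite lerBrDl -lerBrDr half2.
  by rewrite [p t]itv0_clamp_top ?ltW// addrAC subrr add0r.
have pc : continuous p.
  move=> t; apply: (@continuous_comp I R J set_val (itv0_clamp half)).
    exact: set_val_itv0_continuous.
  exact: itv0_clamp_continuous.
have qc : continuous q.
  move=> t.
  apply: (@continuous_comp I R J (fun t => 1 - set_val t) (itv0_clamp half)).
    apply: (@cvgB _ R^o I (nbhs t) _ (cst 1) set_val); first exact: cvg_cst.
    exact: set_val_itv0_continuous.
  exact: itv0_clamp_continuous.
have fS a : (fun t => f t a) \in
    @bdC_pred R I [set (itv0_bot one : I); (itv0_top one : I)] A.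
  apply/asboolP; split=> [t|t].
    rewrite (_ : (fun t => f t a) = fun t => gamma a (p t) +
      sigma (gamma (sigma a) (q t)) - gamma a (itv0_top half)); last first.
      by apply/funext => u; exact: fE.
    apply: (@cvgB _ (normed A) I (nbhs t)); last exact: cvg_cst.
    apply: (@cvgD _ (normed A) I (nbhs t)).
      exact: (@continuous_comp I J (normed A) _ _ _ (pc t)
        (@bdC_continuous _ _ _ _ (gamma a) _)).
    apply: (@continuous_comp I (normed A) (normed A) _ sigma).
      exact: (@continuous_comp I J (normed A) _ _ _ (qc t)
        (@bdC_continuous _ _ _ _ (gamma (sigma a)) _)).
    exact: starhom_continuous.
  move=> [->|->].
    rewrite /f /set_val/= invr_ge0 ler0n /=.
    apply: bdC_scalars; exact: itv0_clampK.
  rewrite /f /set_val/= leNgt invf_lt1// ltr1n/=.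
  rewrite -[X in scalars X]/(sigma (gamma (sigma a) (q (itv0_top one)))).
  (* At t = 1 the path [gamma (sigma a)] is read at 0, where it is scalar, and [sigma], being linear
     and unital, fixes scalars. *)
  have [c ->] : scalars (gamma (sigma a) (q (itv0_top one))).
    apply: bdC_scalars; apply: itv0_clampK.
    by rewrite /set_val/= subrr.
  by exists c; rewrite linearZ/= rmorph1.
exists (bdC_family fS) => a; apply/funext => t.
have sigmaDB (x y z : A) : sigma (x + y - z) = sigma x + sigma y - sigma z.
  by rewrite raddfB raddfD.
(* The closed formula avoids a case distinction on t: the flip exchanges [p] and [q], [sigma]
   exchanges the first two terms, and [gs] matches the third. *)
rewrite /suspension_flip/= !fE sigmaDB !sK gs.
have -> : p (itv0_flip t) = q t by [].
have -> : q (itv0_flip t) = p t.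
  by rewrite /q/p [set_val (itv0_flip t)]/(1 - set_val t) subKr.
by rewrite [sigma _ + _]addrC.
Qed.

End suspension_cone.

Theorem proposition3p3 (R : realType) :
  (forall (A : cstarAlgType R) (sigma : {starhom A -> A}),
     involutive sigma -> free_action sigma ->
     ((exists phi : {starhom A -> suspension A},
         suspension_equivariant sigma phi) <->
      (exists gamma : {starhom A -> cone A},
         cone_equivariant sigma gamma))) /\
  ((forall (A : cstarAlgType R) (sigma : {starhom A -> A}),
      involutive sigma -> free_action sigma ->
      ~ exists phi : {starhom A -> suspension A},
          suspension_equivariant sigma phi) <->
   (forall (A : cstarAlgType R) (sigma : {starhom A -> A}),
      involutive sigma -> free_action sigma ->
      ~ exists gamma : {starhom A -> cone A},
          cone_equivariant sigma gamma)).
Proof.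
have equiv (A : cstarAlgType R) (sigma : {starhom A -> A}) : involutive sigma ->
    (exists phi : {starhom A -> suspension A},
       suspension_equivariant sigma phi) <->
    (exists gamma : {starhom A -> cone A}, cone_equivariant sigma gamma).
  move=> sK; split=> [[phi]|[gamma]]; first exact: cone_of_suspension.
  exact: suspension_of_cone.
split=> [A sigma sK _|]; first exact: equiv.
by split=> no A sigma sK sfree /(equiv _ _ sK); exact: no.
Qed.
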